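(* Let $C\ge 1$ and let $E$ be a non-zero complex Banach space with the $C$-primary factorisation property. Put $A_E=\mathcal{B}(E)/\mathcal{M}_E$. Then, for every $a\in A_E$, $$C_{\mathrm{pi}}^{A_E}(a)\le C\qquad\text{or}\qquad C_{\mathrm{pi}}^{A_E}(1_{A_E}-a)\le C.$$
   Context: $\mathcal{B}(E)$ denotes the Banach algebra of bounded linear operators on $E$ and $\mathrm{Id}_E$ the identity operator. $E$ has the $C$-primary factorisation property ($C$-PFP) if for every $T\in\mathcal{B}(E)$ there are $U,V\in\mathcal{B}(E)$ with $UTV=\mathrm{Id}_E$ or $U(\mathrm{Id}_E-T)V=\mathrm{Id}_E$ and $\|U\|\,\|V\|\le C$. Put $\mathcal{M}_E=\{T\in\mathcal{B}(E): \text{there are no } U,V\in\mathcal{B}(E) \text{ with } UTV=\mathrm{Id}_E\}$; for $E\neq\{0\}$ with the $C$-PFP this is a closed proper two-sided ideal of $\mathcal{B}(E)$, and $\mathcal{B}(E)/\mathcal{M}_E$ carries the quotient norm. For a unital Banach algebra $A$ and $a\in A\setminus\{0\}$, $C_{\mathrm{pi}}^A(a)=\inf\{\|b\|\,\|c\|: b,c\in A,\ bac=1_A\}$, with value $\infty$ if no such $b,c$ exist; also $C_{\mathrm{pi}}^A(0)=\infty$. *)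

(* Defs.v *)
From HB Require Import structures.
From mathcomp Require Import all_boot all_order all_algebra.
From mathcomp Require Import generic_quotient ring_quotient complex.
From mathcomp Require Import all_classical all_reals all_analysis.

Set Implicit Arguments.
Unset Strict Implicit.
Unset Printing Implicit Defensive.

Import Order.TTheory GRing.Theory Num.Theory.
Import numFieldNormedType.Exports.

Local Open Scope classical_set_scope.
Local Open Scope ring_scope.
Local Open Scope complex_scope.
Local Open Scope quotient_scope.

(* MathComp only provides quotient rings of commutative rings. *)
HB.mixin Record isTwoSided (A : pzRingType) (S : A -> bool) := {
  twosidedMl : forall a u : A, u \in S -> a * u \in S;
  twosidedMr : forall a u : A, u \in S -> u * a \in S
}.

#[short(type="ideal2")]
HB.structure Definition Ideal2 (A : pzRingType) :=
  {S of GRing.ZmodClosed A S & isTwoSided A S}.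

Definition quotient_ring (A : pzRingType) (I : ideal2 A) : Type :=
  Quotient.quot I.

Section QuotientRing.
Variables (A : pzRingType) (I : ideal2 A).
Local Notation Q := (quotient_ring I).

HB.instance Definition _ := GRing.Zmodule.copy Q (Quotient.quot I).

Definition qclass (x : A) : Q := \pi_(Quotient.quot I) x.
Definition qrepr (q : Q) : A := repr (q : Quotient.quot I).

Definition qmul (p q : Q) : Q := qclass (qrepr p * qrepr q).

Lemma qreprK : cancel qrepr qclass.
Proof. by move=> q; rewrite /qclass /qrepr reprK. Qed.

Lemma qclassE x y : (qclass x == qclass y) = (x - y \in I).
Proof. by rewrite /qclass Quotient.idealrBE. Qed.

Lemma qclassD x y : qclass (x + y) = qclass x + qclass y.
Proof. by rewrite /qclass; exact: (Quotient.pi_add I). Qed.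

Lemma qclassM x y : qmul (qclass x) (qclass y) = qclass (x * y).
Proof.
have h z : qrepr (qclass z) - z \in I by rewrite -qclassE qreprK.
apply/eqP; rewrite /qmul qclassE.
rewrite -[qrepr _ * _](addrNK (x * qrepr (qclass y))).
by rewrite -addrA -mulrBl -mulrBr rpredD ?(twosidedMr _ _ (h x), twosidedMl _ _ (h y)).
Qed.

Fact qmulA : associative qmul.
Proof.
move=> x y z; rewrite -[x]qreprK -[y]qreprK -[z]qreprK.
by rewrite !qclassM mulrA.
Qed.

Fact qmul1r : left_id (qclass 1) qmul.
Proof. by move=> x; rewrite -[x]qreprK qclassM mul1r. Qed.

Fact qmulr1 : right_id (qclass 1) qmul.
Proof. by move=> x; rewrite -[x]qreprK qclassM mulr1. Qed.

Fact qmulDl : left_distributive qmul +%R.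
Proof.
move=> x y z; rewrite -[x]qreprK -[y]qreprK -[z]qreprK.
by rewrite -qclassD !qclassM -qclassD mulrDl.
Qed.

Fact qmulDr : right_distributive qmul +%R.
Proof.
move=> x y z; rewrite -[x]qreprK -[y]qreprK -[z]qreprK.
by rewrite -qclassD !qclassM -qclassD mulrDr.
Qed.

HB.instance Definition _ := GRing.Zmodule_isPzRing.Build Q
  qmulA qmul1r qmulr1 qmulDl qmulDr.

Definition quotient_norm (R : realType) (nrm : A -> R) (q : Q) : R :=
  inf [set nrm x | x in [set x | qclass x = q]].

End QuotientRing.

Section BoundedOperators.
Variables (R : realType) (E : normedModType R[i]).

Definition bounded_op : {pred E -> E} :=
  fun T => `[< linear T /\ continuous T >].

Fact bounded_op_submod_closed : submod_closed bounded_op.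
Proof.
split.
  apply/asboolP; split; first by move=> a x y; rewrite /= scaler0 addr0.
  by move=> x; exact: cvg_cst.
move=> a S T /asboolP[lS cS] /asboolP[lT cT]; apply/asboolP; split.
  move=> b x y; rewrite /= !fctE lS lT !scalerDr !scalerA mulrC.
  by rewrite addrACA.
by move=> x; apply: cvgD; [apply: cvgZr; exact: cS|exact: cT].
Qed.
HB.instance Definition _ := GRing.isSubmodClosed.Build R[i] (E -> E)
  bounded_op bounded_op_submod_closed.

Record bop := Bop { bop_fun :> E -> E; bop_funP : bop_fun \in bounded_op }.

HB.instance Definition _ := [isSub for bop_fun].
HB.instance Definition _ := [Choice of bop by <:].
HB.instance Definition _ := [SubChoice_isSubLmodule of bop by <:].

Lemma bopP (S T : bop) : (forall x, S x = T x) -> S = T.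
Proof. by move=> h; apply: val_inj; apply/funext. Qed.

Fact bop_one_subproof : (idfun : E -> E) \in bounded_op.
Proof. by apply/asboolP; split => // x; exact: cvg_id. Qed.
Definition bop_one : bop := Bop bop_one_subproof.

Fact bop_mul_subproof (S T : bop) : S \o T \in bounded_op.
Proof.
have /asboolP[lS cS] := bop_funP S; have /asboolP[lT cT] := bop_funP T.
apply/asboolP.
split=> [a x y|x]; first by rewrite /= lT lS.
by apply: continuous_comp; [exact: cT|exact: cS].
Qed.
Definition bop_mul (S T : bop) : bop := Bop (bop_mul_subproof S T).

Fact bop_mulA : associative bop_mul.
Proof. by move=> S T U; apply: bopP. Qed.
Fact bop_mul1r : left_id bop_one bop_mul.
Proof. by move=> T; apply: bopP. Qed.
Fact bop_mulr1 : right_id bop_one bop_mul.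
Proof. by move=> T; apply: bopP. Qed.
Fact bop_mulDl : left_distributive bop_mul +%R.
Proof. by move=> S T U; apply: bopP. Qed.
Fact bop_mulDr : right_distributive bop_mul +%R.
Proof.
move=> S T U; apply: bopP => x; have /asboolP[lS _] := bop_funP S.
by have := lS 1 (T x) (U x); rewrite !scale1r.
Qed.

HB.instance Definition _ := GRing.Zmodule_isPzRing.Build bop
  bop_mulA bop_mul1r bop_mulr1 bop_mulDl bop_mulDr.

(* The norm of [E] takes its values in [R[i]]; it is real and nonnegative. *)
Definition opnorm (T : bop) : R :=
  sup [set complex.Re `|T x| | x in [set x : E | `|x| <= 1]].

Lemma opnorm_has_sup (T : bop) :
  has_sup [set complex.Re `|T x| | x in [set x : E | `|x| <= 1]].
Proof.
have /asboolP[lT cT] := bop_funP T.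
pose f := HB.pack_for {linear E -> E} (T : E -> E)
  (GRing.isLinear.Build _ _ _ _ (T : E -> E) lT).
split; first by exists (complex.Re `|T 0|), 0 => //=; rewrite normr0.
have /bounded_funP/(_ 1)[M hM] : bounded_near f (nbhs 0).
  by apply: continuous_linear_bounded; exact: cT.
exists (complex.Re M) => _ [x /= x1 <-].
by have := hM x x1; rewrite lecE => /andP[].
Qed.

Definition PFP (C : R) : Prop :=
  forall T : bop, exists U V : bop,
    (U * T * V = 1 \/ U * (1 - T) * V = 1) /\ opnorm U * opnorm V <= C.

Definition non_factoring : {pred bop} :=
  fun T => `[< ~ exists U V : bop, U * T * V = 1 >].

End BoundedOperators.

Arguments PFP {R} E C.

Section FactorisationIdeal.
Variables (R : realType) (E : normedModType R[i]) (C : R).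
Hypotheses (E_neq0 : exists x : E, x != 0) (pfpE : PFP E C).

(* The section hypotheses are parameters of [M_E], so that the ideal structure
   of [M_E] can be a canonical instance. *)
Definition M_E of (exists x : E, x != 0) & PFP E C : bop E -> bool :=
  @non_factoring R E.
Local Notation M := (M_E E_neq0 pfpE).

Fact M_E_zmod_closed : zmod_closed M.
Proof.
split.
  apply/asboolP => -[U [V]]; rewrite mulr0 mul0r => h.
  case: E_neq0 => x /eqP; apply.
  by have /(congr1 (fun T : bop E => T x)) := h.
move=> S T /asboolP nS /asboolP nT; apply/asboolP => -[U [V h]].
have [A [B [[hS|hT] _]]] := pfpE (U * S * V).
  by apply: nS; exists (A * U), (V * B); rewrite -hS !mulrA.
have e : 1 - U * S * V = - (U * T * V).
  by rewrite -h mulrBr mulrBl addrAC subrr sub0r.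
apply: nT; exists (- (A * U)), (V * B).
by rewrite -hT e mulrN !mulNr !mulrA.
Qed.

Fact M_E_mull (S T : bop E) : T \in M -> S * T \in M.
Proof.
move=> /asboolP nT; apply/asboolP => -[U [V h]]; apply: nT.
by exists (U * S), V; rewrite -h !mulrA.
Qed.

Fact M_E_mulr (S T : bop E) : T \in M -> T * S \in M.
Proof.
move=> /asboolP nT; apply/asboolP => -[U [V h]]; apply: nT.
by exists U, (S * V); rewrite -h !mulrA.
Qed.

HB.instance Definition _ :=
  GRing.isZmodClosed.Build (bop E) M M_E_zmod_closed.
HB.instance Definition _ := isTwoSided.Build (bop E) M M_E_mull M_E_mulr.

Definition M_E_ideal : ideal2 (bop E) := Ideal2.clone (bop E) M _.

Definition A_E : pzRingType := quotient_ring M_E_ideal.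
Definition A_E_norm : A_E -> R := quotient_norm (@opnorm R E).

End FactorisationIdeal.

Arguments A_E_norm {R E C} E_neq0 pfpE _.

(* [nrm] is the norm of [A]; note that [ereal_inf set0 = +oo]. *)
Definition Cpi (R : realType) (A : pzRingType) (nrm : A -> R) (a : A) : \bar R :=
  if a == 0 then +oo%E
  else ereal_inf [set r | exists b c : A,
                    b * a * c = 1 /\ r = (nrm b * nrm c)%:E].

(* Main.v *)
Require Import Defs.
From mathcomp Require Import all_boot all_order all_algebra complex.
From mathcomp Require Import all_classical all_reals all_analysis.

Import Order.TTheory GRing.Theory Num.Theory.
Import numFieldNormedType.Exports.

Local Open Scope ring_scope.
Local Open Scope complex_scope.

(** Lift [a] to an operator [T] and apply the factorisation property to [T]. The quotient map is a
    unital ring homomorphism that does not increase norms ([quotient_norm_qclass]), so the classes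
    of [U] and [V] factor the unit through [a] or [1 - a] at cost at most [C]; [Cpi_qclass_le]
    carries this transfer. *)

Lemma opnorm_ge0 (R : realType) (E : normedModType R[i]) (T : bop E) :
  0 <= opnorm T.
Proof.
apply: (@le_trans _ _ (complex.Re `|T 0|)).
  by have := normr_ge0 (T 0); rewrite lecE => /andP[].
apply: sup_upper_bound; first exact: opnorm_has_sup.
by exists 0 => //=; rewrite normr0.
Qed.

Lemma qclass0 (A : pzRingType) (I : ideal2 A) : qclass I 0 = 0.
Proof. by apply: (addrI (qclass I 0)); rewrite -qclassD !addr0. Qed.

Section QuotientNorm.
Variables (R : realType) (A : pzRingType) (I : ideal2 A) (nrm : A -> R).
Hypothesis nrm_ge0 : forall x, 0 <= nrm x.

Lemma quotient_norm_ge0 (q : quotient_ring I) : 0 <= quotient_norm nrm q.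
Proof.
apply: lb_le_inf => [|_ [x _ <-]//].
by exists (nrm (qrepr q)), (qrepr q) => //=; exact: qreprK.
Qed.

Lemma quotient_norm_qclass (x : A) :
  quotient_norm nrm (qclass I x) <= nrm x.
Proof.
by apply: ge_inf; [exists 0 => _ [y _ <-]|exists x].
Qed.

(** Properness of [I] excludes the [+oo] branch of [Cpi]: the class of an element through which [1]
    factors is then non-zero. *)
Lemma Cpi_qclass_le (U T V : A) : 1 \notin I -> U * T * V = 1 ->
  (Cpi (@quotient_norm A I R nrm) (qclass I T) <= (nrm U * nrm V)%:E)%E.
Proof.
move=> I1 UTV.
have qUTV : qclass I U * qclass I T * qclass I V = 1.
  by rewrite -[RHS]/(qclass I 1) -UTV -!qclassM.
rewrite /Cpi; case: eqP => [T0|_].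
  (* A zero class would give [0 = 1] in the quotient, that is, [1] in [I]. *)
  have /eqP := qUTV; rewrite T0 mulr0 mul0r -qclass0 eq_sym.
  by rewrite -[1]/(qclass I 1) qclassE subr0 (negPf I1).
apply: (@le_trans _ _ (quotient_norm nrm (qclass I U) *
                       quotient_norm nrm (qclass I V))%:E).
  by apply: ereal_inf_lbound; exists (qclass I U), (qclass I V).
by rewrite lee_fin ler_pM ?quotient_norm_ge0 ?quotient_norm_qclass.
Qed.

End QuotientNorm.

Theorem proposition5p3 (R : realType) (C : R) (C_ge1 : 1 <= C)
    (E : completeNormedModType R[i]) (E_neq0 : exists x : E, x != 0)
    (pfpE : PFP E C) (a : A_E E_neq0 pfpE) :
  (Cpi (A_E_norm E_neq0 pfpE) a <= C%:E)%E \/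
  (Cpi (A_E_norm E_neq0 pfpE) (1 - a) <= C%:E)%E.
Proof.
pose I := M_E_ideal E_neq0 pfpE.
have I1 : 1 \notin I.
  (* The identity factors through itself, so the ideal is proper. *)
  by apply/negP => /asboolP; apply; exists 1, 1; rewrite !mulr1.
have Cpi_le (U T V : bop E) : U * T * V = 1 -> opnorm U * opnorm V <= C ->
    (Cpi (A_E_norm E_neq0 pfpE) (qclass I T) <= C%:E)%E.
  move=> UTV UVC; apply: (@le_trans _ _ (opnorm U * opnorm V)%:E) => //.
  by apply: Cpi_qclass_le => //; exact: opnorm_ge0.
have aE : a = qclass I (qrepr a) by rewrite qreprK.
have [U [V [[UTV|UTV] UVC]]] := pfpE (qrepr a).
  by left; rewrite aE; exact: Cpi_le UTV UVC.
right; suff -> : 1 - a = qclass I (1 - qrepr a) by exact: Cpi_le UTV UVC.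
(* The unit of the quotient is by definition the class of [1]. *)
by apply/eqP; rewrite subr_eq [in X in _ + X]aE -qclassD subrK.
Qed.
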